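(* Let $C\subset\mathbb{R}^n$ be nonempty, compact and convex, let $U\subset\mathbb{R}^n$ be open and convex with $C\cap U\neq\emptyset$, and let $f:U\to\mathbb{R}$ be twice continuously differentiable and convex. Assume boundary blow-up: for every $\alpha\in\mathbb{R}$ such that $L_\alpha:=\{p\in C\cap U\mid f(p)\le\alpha\}$ is nonempty, $\operatorname{dist}(L_\alpha,U^c)>0$. Run the domain-aware Armijo projected gradient method (described in the context) from $p^{(0)}\in C\cap U$ with parameters $\bar\alpha>0$, $\sigma,\rho\in(0,1)$, $\varepsilon\ge 0$. Then: (i) every backtracking loop terminates after finitely many step-size reductions; (ii) every accepted trial point $\tilde p^{(k)}$ belongs to $\mathcal F^{(0)}$, and hence every generated iterate remains in $\mathcal F^{(0)}$; (iii) the accepted step sizes satisfy $$\underline\alpha\le\alpha_k\le\bar\alpha,\qquad \underline\alpha:=\min\{\bar\alpha,\rho\alpha_\star\}>0,$$ where $$\alpha_\star:=\min\left\{\frac{r}{G},\frac{2(1-\sigma)}{L}\right\},\quad G:=\max\Big\{1,\max_{p\in\mathcal F^{(0)}}\|\nabla f(p)\|\Big\},\quad L:=\max\Big\{1,\max_{q\in\mathcal K_r}\|\nabla^2 f(q)\|_2\Big\};$$ (iv) every accepted trial point satisfies $$f(\tilde p^{(k)})\le f(p^{(k)})-\sigma\alpha_k\|\mathcal G_{\alpha_k}(p^{(k)})\|^2.$$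
   Context: $\|\cdot\|$ is the Euclidean norm, $\|\cdot\|_2$ the spectral norm of a matrix, $P_C$ the Euclidean projection onto $C$, $U^c=\mathbb{R}^n\setminus U$, and $\operatorname{dist}(A,B)=\inf\{\|a-b\|: a\in A,b\in B\}$, with the convention $\operatorname{dist}(A,\emptyset)=+\infty$; $\operatorname{dist}(q,B)=\operatorname{dist}(\{q\},B)$. Initial sublevel set: $\mathcal F^{(0)}:=\{p\in C\cap U\mid f(p)\le f(p^{(0)})\}$. Put $d:=\operatorname{dist}(\mathcal F^{(0)},U^c)$, $r:=\min\{1,d/2\}$ and $\mathcal K_r:=\{q\in\mathbb{R}^n\mid \operatorname{dist}(q,\mathcal F^{(0)})\le r\}$ (under the hypotheses $d>0$ and $\mathcal K_r$ is a compact subset of $U$). Gradient mapping: for $p\in C\cap U$ and $\alpha>0$, $\mathcal G_\alpha(p):=\alpha^{-1}\big(p-P_C(p-\alpha\nabla f(p))\big)$. Domain-aware Armijo projected gradient method. Input: $p^{(0)}\in C\cap U$, $\bar\alpha>0$, $\sigma,\rho\in(0,1)$, $\varepsilon\ge0$. For $k=0,1,\dots$: (backtracking loop) start with $\alpha:=\bar\alpha$ and repeat: set $q:=P_C(p^{(k)}-\alpha\nabla f(p^{(k)}))$; if $q\in U$ and (tested only when $q\in U$) $f(q)\le f(p^{(k)})+\sigma\nabla f(p^{(k)})^\top(q-p^{(k)})$, accept the trial by setting $\alpha_k:=\alpha$, $\tilde p^{(k)}:=q$ and exit the loop; otherwise replace $\alpha$ by $\rho\alpha$ and repeat. After acceptance,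 if $\|\tilde p^{(k)}-p^{(k)}\|/\alpha_k\le\varepsilon$, terminate and return $p^{(k)}$; otherwise set $p^{(k+1)}:=\tilde p^{(k)}$. *)

(* Defs.v *)
From HB Require Import structures.
From mathcomp Require Import all_boot all_order all_algebra.
From mathcomp Require Import all_classical all_reals all_analysis.

Set Implicit Arguments.
Unset Strict Implicit.
Unset Printing Implicit Defensive.

Import Order.TTheory GRing.Theory Num.Theory.
Import numFieldNormedType.Exports.

Local Open Scope classical_set_scope.
Local Open Scope ring_scope.

(* Points of R^n are row vectors.  The library norm on 'rV[R]_n is the
   sup norm: it gives the usual topology, but not the norm wanted here. *)

Definition dotp (R : realType) (n : nat) (u v : 'rV[R]_n) : R :=
  \sum_(i < n) u 0 i * v 0 i.

Definition enorm (R : realType) (n : nat) (v : 'rV[R]_n) : R :=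
  Num.sqrt (dotp v v).

(* x *m A^T is the product A x in row form. *)
Definition spectral_norm (R : realType) (m n : nat) (A : 'M[R]_(m, n)) : R :=
  sup [set enorm (x *m A^T) | x in [set x : 'rV[R]_n | enorm x <= 1]].

(* Extended-real valued: the distance to the empty set is +oo. *)
Definition set_dist (R : realType) (n : nat) (A B : set 'rV[R]_n) : \bar R :=
  ereal_inf [set e | exists a b, [/\ A a, B b & e = (enorm (a - b))%:E]].

(* The nearest point of C; get returns a default value if there is none. *)
Definition proj (R : realType) (n : nat) (C : set 'rV[R]_n) (x : 'rV[R]_n) :
    'rV[R]_n :=
  get [set q | C q /\ forall c, C c -> enorm (x - q) <= enorm (x - c)].

Definition is_max (R : realType) (A : set R) (m : R) : Prop :=
  A m /\ ubound A m.

(* A function on the open set U is given as a total function; only its values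
   on U matter: all derivatives below are used at points of U only. *)

Definition grad (R : realType) (n : nat) (f : 'rV[R]_n -> R) (p : 'rV[R]_n) :
    'rV[R]_n :=
  \row_(i < n) ('D_('e_i) f p : R).

(* The (i, j) entry is the i-th partial derivative of the j-th partial
   derivative of f. *)
Definition hess (R : realType) (n : nat) (f : 'rV[R]_n -> R) (p : 'rV[R]_n) :
    'M[R]_n :=
  'J (grad f) p.

Definition C2_on (R : realType) (n : nat) (U : set 'rV[R]_n)
    (f : 'rV[R]_n -> R) : Prop :=
  forall p, U p ->
    [/\ differentiable f p, differentiable (grad f) p
      & {for p, continuous (hess f)}].

Definition sublevel (R : realType) (n : nat) (C U : set 'rV[R]_n)
    (f : 'rV[R]_n -> R) (a : R) : set 'rV[R]_n :=
  [set p | [/\ C p, U p & f p <= a]].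

Definition boundary_blowup (R : realType) (n : nat) (C U : set 'rV[R]_n)
    (f : 'rV[R]_n -> R) : Prop :=
  forall a : R, sublevel C U f a !=set0 ->
    (0 < set_dist (sublevel C U f a) (~` U))%E.

Definition safe_radius (R : realType) (n : nat) (U F : set 'rV[R]_n) : R :=
  fine (mine 1 (set_dist F (~` U) * (2^-1)%:E))%E.

Definition neighborhood (R : realType) (n : nat) (F : set 'rV[R]_n) (r : R) :
    set 'rV[R]_n :=
  [set q | (set_dist [set q] F <= r%:E)%E].

Definition trial (R : realType) (n : nat) (C : set 'rV[R]_n)
    (f : 'rV[R]_n -> R) (p : 'rV[R]_n) (a : R) : 'rV[R]_n :=
  proj C (p - a *: grad f p).

Definition gradient_mapping (R : realType) (n : nat) (C : set 'rV[R]_n)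
    (f : 'rV[R]_n -> R) (a : R) (p : 'rV[R]_n) : 'rV[R]_n :=
  a^-1 *: (p - trial C f p a).

Definition armijo_test (R : realType) (n : nat) (C U : set 'rV[R]_n)
    (f : 'rV[R]_n -> R) (sigma : R) (p : 'rV[R]_n) (a : R) : Prop :=
  let q := trial C f p a in
  U q /\ f q <= f p + sigma * dotp (grad f p) (q - p).

(* backtrack ... p j a: the backtracking loop at p reaches the step size a
   after j reductions. *)
Inductive backtrack (R : realType) (n : nat) (C U : set 'rV[R]_n)
    (f : 'rV[R]_n -> R) (abar sigma rho : R) (p : 'rV[R]_n) :
    nat -> R -> Prop :=
| backtrack_start : backtrack C U f abar sigma rho p 0 abar
| backtrack_reduce (j : nat) (a : R) :
    backtrack C U f abar sigma rho p j a ->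
    ~ armijo_test C U f sigma p a ->
    backtrack C U f abar sigma rho p j.+1 (rho * a).

Definition accepted_step (R : realType) (n : nat) (C U : set 'rV[R]_n)
    (f : 'rV[R]_n -> R) (abar sigma rho : R) (p : 'rV[R]_n) (a : R) : Prop :=
  (exists j, backtrack C U f abar sigma rho p j a) /\
  armijo_test C U f sigma p a.

(* iterate ... k p: the method reaches its k-th pass without having stopped,
   and its current point is then p. *)
Inductive iterate (R : realType) (n : nat) (C U : set 'rV[R]_n)
    (f : 'rV[R]_n -> R) (abar sigma rho eps : R) (p0 : 'rV[R]_n) :
    nat -> 'rV[R]_n -> Prop :=
| iterate_start : iterate C U f abar sigma rho eps p0 0 p0
| iterate_next (k : nat) (p : 'rV[R]_n) (a : R) :
    iterate C U f abar sigma rho eps p0 k p ->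
    accepted_step C U f abar sigma rho p a ->
    ~ (enorm (trial C f p a - p) / a <= eps) ->
    iterate C U f abar sigma rho eps p0 k.+1 (trial C f p a).

(* Main.v *)
Require Import Defs.
From HB Require Import structures.
From mathcomp Require Import all_boot all_order all_algebra.
From mathcomp Require Import all_classical all_reals all_analysis.
From mathcomp Require Import ring lra.

Set Implicit Arguments.
Unset Strict Implicit.
Unset Printing Implicit Defensive.

Import Order.TTheory GRing.Theory Num.Theory.
Import numFieldNormedType.Exports.

Local Open Scope classical_set_scope.
Local Open Scope ring_scope.

(** Fix an iterate p in the initial sublevel set F, and let h be the step from
    p to the trial point of size a.  The projection inequality, tested at p
    itself, gives

      |h|^2 <= - a <grad f(p), h>      (trial_descent),

    hence |h| <= a |grad f(p)|         (trial_step_le).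

    If a <= r / G, the whole segment from p to p + h therefore stays within
    distance r of F, that is, inside the tube K_r, which lies in U because r is
    smaller than the distance from F to the complement of U
    (safe_radius_spec).  On K_r the Hessian has spectral norm at most L, so the
    second-order upper bound (descent_lemma) reads

      f(p + h) <= f(p) + <grad f(p), h> + (L/2) |h|^2.

    Inserting the first inequality, the quadratic term is at most
    - (L a/2) <grad f(p), h>, and for a <= 2 (1 - sigma) / L it consumes at most
    the fraction 1 - sigma of the decrease: the Armijo test holds
    (armijo_small_step).  So every step size below
    alpha_star = min (r / G) (2 (1 - sigma) / L) passes, uniformly over F.

    The rest follows.  The trial sizes rho^j abar tend to 0, so the loop stops
    (backtrack_terminates); a reduced size rho a was preceded by a rejected size
    a > alpha_star, which is the lower bound (backtrack_bounds); and |h|^2 / a is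
    a times the squared norm of the gradient mapping, which turns the Armijo
    test into the stated decrease (armijo_sufficient_decrease).  That decrease keeps
    the next point in F, so the argument applies to it in turn.

    The constants G and L exist because F and K_r are compact: a positive
    distance from F to the complement of U keeps the closure of F inside U,
    where f is continuous (sublevel_compact), and K_r is the sum of F and a
    closed ball (neighborhood_compact). *)

(** * Euclidean inner product and norm *)

Section euclidean.
Context {R : realType} {n : nat}.
Implicit Types (u v w x : 'rV[R]_n) (k : R).

Lemma dotpC u v : dotp u v = dotp v u.
Proof. by apply: eq_bigr => i _; rewrite mulrC. Qed.

Lemma dotpDl u v w : dotp (u + v) w = dotp u w + dotp v w.
Proof. by rewrite -big_split/=; apply: eq_bigr => i _; rewrite mxE mulrDl. Qed.

Lemma dotpZl k u v : dotp (k *: u) v = k * dotp u v.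
Proof.
by rewrite /dotp mulr_sumr; apply: eq_bigr => i _; rewrite mxE mulrA.
Qed.

Lemma dotpDr u v w : dotp w (u + v) = dotp w u + dotp w v.
Proof. by rewrite dotpC dotpDl !(dotpC w). Qed.

Lemma dotpZr k u v : dotp u (k *: v) = k * dotp u v.
Proof. by rewrite dotpC dotpZl dotpC. Qed.

Lemma dotpNl u v : dotp (- u) v = - dotp u v.
Proof. by rewrite -scaleN1r dotpZl mulN1r. Qed.

Lemma dotpNr u v : dotp u (- v) = - dotp u v.
Proof. by rewrite dotpC dotpNl dotpC. Qed.

Definition dotpE := (dotpDl, dotpDr, dotpNl, dotpNr, dotpZl, dotpZr).

Lemma dotp_ge0 u : 0 <= dotp u u.
Proof. by apply: sumr_ge0 => i _; rewrite -expr2 sqr_ge0. Qed.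

Lemma dotp_eq0 u : dotp u u = 0 -> u = 0.
Proof.
move=> /eqP; rewrite psumr_eq0 => [/allP u0|i _]; last first.
  by rewrite -expr2 sqr_ge0.
apply/rowP => i; rewrite mxE; apply/eqP.
by have := u0 i (mem_index_enum _); rewrite /= -expr2 sqrf_eq0.
Qed.

Lemma dotp_sqrB u v k :
  dotp (u - k *: v) (u - k *: v) =
    dotp u u - 2 * k * dotp u v + k ^+ 2 * dotp v v.
Proof. by rewrite !dotpE (dotpC v u); ring. Qed.

Lemma enorm_ge0 u : 0 <= enorm u.
Proof. exact: sqrtr_ge0. Qed.

Lemma sqr_enorm u : enorm u ^+ 2 = dotp u u.
Proof. by rewrite sqr_sqrtr ?dotp_ge0. Qed.

Lemma enorm_le k u : 0 <= k -> (enorm u <= k) = (dotp u u <= k ^+ 2).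
Proof. by move=> k0; rewrite -sqr_enorm ler_sqr ?nnegrE ?enorm_ge0. Qed.

Lemma enorm_eq0 u : enorm u = 0 -> u = 0.
Proof. by move=> u0; apply: dotp_eq0; rewrite -sqr_enorm u0 expr0n. Qed.

Lemma enorm0 : enorm (0 : 'rV[R]_n) = 0.
Proof. by rewrite /enorm -(scale0r 0) dotpZl mul0r sqrtr0. Qed.

Lemma enormZ k u : enorm (k *: u) = `|k| * enorm u.
Proof. by rewrite /enorm !dotpE mulrA -expr2 sqrtrM ?sqr_ge0// sqrtr_sqr. Qed.

Lemma enormN u : enorm (- u) = enorm u.
Proof. by rewrite /enorm !dotpE opprK. Qed.

Lemma enormB u v : enorm (u - v) = enorm (v - u).
Proof. by rewrite -enormN opprB. Qed.

(** Cauchy-Schwarz, squared: the squared norm of (v.v) u - (u.v) v equals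
    (v.v) ((u.u) (v.v) - (u.v)^2), which is therefore nonnegative. *)
Lemma dotp_sqr_le u v : dotp u v ^+ 2 <= dotp u u * dotp v v.
Proof.
have [v0|v0] := eqVneq (dotp v v) 0.
  have -> : v = 0 by exact: dotp_eq0.
  by rewrite -(scale0r 0) !dotpZr !mul0r expr0n mulr0.
have vv : 0 < dotp v v by rewrite lt_neqAle eq_sym v0 dotp_ge0.
have := dotp_ge0 (dotp v v *: u - dotp u v *: v).
rewrite !dotpE (dotpC v u) => h.
rewrite -subr_ge0 -(pmulr_rge0 _ vv); apply: le_trans h _.
by rewrite le_eqVlt; apply/orP; left; apply/eqP; ring.
Qed.

Lemma cauchy_schwarz u v : `|dotp u v| <= enorm u * enorm v.
Proof.
rewrite -ler_sqr ?nnegrE ?mulr_ge0 ?enorm_ge0//.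
by rewrite exprMn !sqr_enorm real_normK ?num_real// dotp_sqr_le.
Qed.

Lemma dotp_le_enorm u v : dotp u v <= enorm u * enorm v.
Proof. exact: le_trans (ler_norm _) (cauchy_schwarz _ _). Qed.

Lemma enormD u v : enorm (u + v) <= enorm u + enorm v.
Proof.
rewrite enorm_le ?addr_ge0 ?enorm_ge0// sqrrD !sqr_enorm !dotpE (dotpC v u).
have := dotp_le_enorm u v; rewrite mulr2n; lra.
Qed.

End euclidean.

(** * Continuity of the norm *)

Section continuity.
Context {R : realType}.

Lemma cvg_sum {T : Type} {F : set_system T} {FF : Filter F} {I : Type}
    (s : seq I) (f : I -> T -> R) (a : I -> R) :
  (forall i, f i @ F --> a i) ->
  (fun x => \sum_(i <- s) f i x) @ F --> \sum_(i <- s) a i.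
Proof.
move=> fa; elim: s => [|i s IHs].
  by under eq_fun do rewrite big_nil; rewrite big_nil; exact: cvg_cst.
by under eq_fun do rewrite big_cons; rewrite big_cons; exact: cvgD.
Qed.

Lemma cvg_entry {T : Type} {F : set_system T} {FF : Filter F} {m n : nat}
    (A : T -> 'M[R]_(m, n)) (B : 'M[R]_(m, n)) i j :
  A @ F --> B -> (fun x => A x i j) @ F --> B i j.
Proof.
move=> AB; apply: (cvg_comp A (fun M : 'M[R]_(m, n) => M i j)) AB _.
exact: coord_continuous.
Qed.

Lemma cvg_sqrt {T : Type} {F : set_system T} {FF : Filter F}
    (f : T -> R) (a : R) :
  f @ F --> a -> (fun x => Num.sqrt (f x)) @ F --> Num.sqrt a.
Proof. by move=> fa; apply: cvg_comp fa _; exact: (@sqrt_continuous R a). Qed.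

Lemma cvg_dotp {T : Type} {F : set_system T} {FF : Filter F} {n : nat}
    (u v : T -> 'rV[R]_n) (a b : 'rV[R]_n) :
  u @ F --> a -> v @ F --> b -> (fun x => dotp (u x) (v x)) @ F --> dotp a b.
Proof.
by move=> ua vb; apply: cvg_sum => i; apply: cvgM; exact: cvg_entry.
Qed.

Lemma cvg_enorm {T : Type} {F : set_system T} {FF : Filter F} {n : nat}
    (u : T -> 'rV[R]_n) (a : 'rV[R]_n) :
  u @ F --> a -> (fun x => enorm (u x)) @ F --> enorm a.
Proof. by move=> ua; apply/cvg_sqrt/cvg_dotp.
Qed.

(** The topology of row vectors comes from the sup norm; this comparison is
    what makes Euclidean balls bounded for it. *)
Lemma norm_le_enorm {n : nat} (u : 'rV[R]_n) : `|u| <= enorm u.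
Proof.
rewrite [leLHS]/Num.Def.normr/= mx_normrE.
apply: bigmax_le; first exact: enorm_ge0.
move=> [i j] _ /=; rewrite (ord1 i) -ler_sqr ?nnegrE ?enorm_ge0//.
rewrite real_normK ?num_real// sqr_enorm /dotp (bigD1 j)//= expr2 lerDl.
by apply: sumr_ge0 => k _; rewrite -expr2 sqr_ge0.
Qed.

End continuity.

(** * The spectral norm *)

Section spectral_norm.
Context {R : realType} {m n : nat}.
Implicit Types (A B : 'M[R]_(m, n)) (x : 'rV[R]_n).

Definition frobenius A : R := Num.sqrt (\sum_i dotp (row i A) (row i A)).

(** Each coordinate of the product is the inner product of x with a row of A,
    so Cauchy-Schwarz applies row by row. *)
Lemma enorm_mulmx_frobenius A x : enorm (x *m A^T) <= frobenius A * enorm x.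
Proof.
have fA : 0 <= \sum_i dotp (row i A) (row i A).
  by apply: sumr_ge0 => i _; exact: dotp_ge0.
rewrite enorm_le ?mulr_ge0 ?enorm_ge0 ?sqrtr_ge0// exprMn sqr_sqrtr// sqr_enorm.
rewrite /dotp mulr_suml; apply: ler_sum => i _.
have -> : (x *m A^T) 0 i = dotp (row i A) x.
  by rewrite mxE; apply: eq_bigr => j _; rewrite !mxE mulrC.
by rewrite -expr2; exact: dotp_sqr_le.
Qed.

Lemma spectral_norm_nonempty A :
  [set enorm (x *m A^T) | x in [set x : 'rV[R]_n | enorm x <= 1]] !=set0.
Proof. by exists (enorm (0 *m A^T)), 0 => //=; rewrite enorm0. Qed.

Lemma spectral_norm_ubound A : ubound
  [set enorm (x *m A^T) | x in [set x : 'rV[R]_n | enorm x <= 1]]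
  (frobenius A).
Proof.
move=> _ [x /= x1 <-]; apply: le_trans (enorm_mulmx_frobenius _ _) _.
by rewrite ler_piMr// sqrtr_ge0.
Qed.

Lemma spectral_norm_le A k :
  (forall x, enorm x <= 1 -> enorm (x *m A^T) <= k) -> spectral_norm A <= k.
Proof.
move=> Ak; apply: ge_sup; first exact: spectral_norm_nonempty.
by move=> _ [x /= x1 <-]; exact: Ak.
Qed.

(** Rescaling x to the unit sphere; the supremum is an upper bound because the
    Frobenius norm bounds the set of values. *)
Lemma enorm_mulmx A x : enorm (x *m A^T) <= spectral_norm A * enorm x.
Proof.
have [x0|x0] := eqVneq (enorm x) 0.
  by rewrite (enorm_eq0 x0) mul0mx !enorm0 mulr0.
have xp : 0 < enorm x by rewrite lt_neqAle eq_sym x0 enorm_ge0.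
rewrite -ler_pdivrMr// mulrC -[X in X * _]ger0_norm ?invr_ge0 ?enorm_ge0//.
rewrite -enormZ scalemxAl; apply: ub_le_sup.
  by exists (frobenius A); exact: spectral_norm_ubound.
exists ((enorm x)^-1 *: x) => //=.
by rewrite enormZ ger0_norm ?invr_ge0 ?enorm_ge0// mulVf.
Qed.

Lemma spectral_norm_subadditive A B :
  spectral_norm A <= spectral_norm B + frobenius (A - B).
Proof.
apply: spectral_norm_le => x x1.
have -> : x *m A^T = x *m B^T + x *m (A - B)^T.
  by rewrite -mulmxDr -linearD/= subrKC.
apply: le_trans (enormD _ _) _; apply: lerD.
  apply: ub_le_sup; last by exists x.
  by exists (frobenius B); exact: spectral_norm_ubound.
by apply: spectral_norm_ubound; exists x.
Qed.

(** By subadditivity the spectral norm is 1-Lipschitz for the Frobenius norm,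
    whose continuity is visible on the entries. *)
Lemma cvg_spectral_norm {T : Type} {F : set_system T} {FF : Filter F}
    (A : T -> 'M[R]_(m, n)) B :
  A @ F --> B -> (fun t => spectral_norm (A t)) @ F --> spectral_norm B.
Proof.
move=> AB.
have fro M : frobenius M = frobenius (- M).
  congr Num.sqrt; apply: eq_bigr => i _.
  by rewrite linearN/= !dotpE opprK.
have fcvg : (fun t => frobenius (A t - B)) @ F --> (0 : R).
  have -> : 0 = frobenius (B - B) :> R.
    rewrite subrr /frobenius big1 ?sqrtr0// => i _.
    by rewrite row0 -(scale0r 0) dotpZl mul0r.
  apply: cvg_sqrt; apply: cvg_sum => i; apply: cvg_sum => j.
  have h : (fun t => row i (A t - B) 0 j) @ F --> row i (B - B) 0 j.
    under eq_fun do rewrite mxE; rewrite mxE; apply: cvg_entry.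
    by apply: cvgB => //; exact: cvg_cst.
  exact: cvgM.
apply/cvgrPdist_le => e e0.
move/cvgr_dist_le : fcvg => /(_ _ e0); apply: filterS => t.
rewrite sub0r normrN ger0_norm ?sqrtr_ge0// => fe.
rewrite ler_norml; apply/andP; split.
  have := spectral_norm_subadditive (A t) B; lra.
have := spectral_norm_subadditive B (A t); rewrite fro opprB; lra.
Qed.

End spectral_norm.

(** * Second-order upper bound along a segment *)

Section calculus.
Context {R : realType} {n : nat}.
Implicit Types (f : 'rV[R]_n -> R) (p q h : 'rV[R]_n).

Lemma is_derive_line (W : normedModType R) (F : 'rV[R]_n -> W) p h (t : R) :
  differentiable F (p + t *: h) ->
  is_derive t 1 (fun s : R => F (p + s *: h)) ('d F (p + t *: h) h).
Proof.
move=> dF.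
set l : R -> 'rV[R]_n := fun s => p + s *: h.
have dl : is_diff t l (fun s : R => s *: h).
  have -> : l = cst p + ( *:%R ^~ h) by [].
  by apply: is_diff_eq; apply/funext => s; rewrite !fctE add0r.
have dFl : differentiable (F \o l) t.
  by apply: differentiable_comp => //; exact: ex_diff.
split; first exact: diff_derivable.
by rewrite deriveE// diff_comp//= diff_val scale1r.
Qed.

Lemma diff_grad f p h : differentiable f p -> 'd f p h = dotp (grad f p) h.
Proof.
move=> df; rewrite {1}[h]row_sum_delta linear_sum; apply: eq_bigr => i _.
by rewrite linearZ/= mxE deriveE// mulrC.
Qed.

Lemma diff_dotp h p : differentiable (fun q => dotp q h) p /\
  'd (fun q => dotp q h) p = (fun q => dotp q h) :> (_ -> _).
Proof.
have lin : linear (fun q => dotp q h : R).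
  by move=> k u v; rewrite dotpDl dotpZl.
pose lM := GRing.isLinear.Build _ _ _ _ _ lin.
pose L : {linear _ -> _} := HB.pack (fun q => dotp q h) lM.
have cL : continuous L.
  move=> q; suff : (fun q => dotp q h) @ nbhs q --> dotp q h by [].
  by apply: cvg_dotp; [exact: cvg_id|exact: cvg_cst].
have dL : differentiable L p by exact/linear_differentiable.
have vL : 'd L p = L :> (_ -> _) by exact: diff_lin.
by split; [exact: dL|exact: vL].
Qed.

Lemma is_derive_f_line f p h (t : R) : differentiable f (p + t *: h) ->
  is_derive t 1 (fun s : R => f (p + s *: h)) (dotp (grad f (p + t *: h)) h).
Proof. by move=> df; rewrite -diff_grad//; exact: is_derive_line. Qed.

(** The chain rule gives <h J, h> with J the Jacobian of the gradient.  It is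
    written here as <h, h J^T>, to which the spectral norm bound applies. *)
Lemma is_derive_grad_line f p h (t : R) :
  differentiable (grad f) (p + t *: h) ->
  is_derive t 1 (fun s : R => dotp (grad f (p + s *: h)) h)
    (dotp h (h *m (hess f (p + t *: h))^T)).
Proof.
move=> df; have [dd de] := diff_dotp h (grad f (p + t *: h)).
have -> : dotp h (h *m (hess f (p + t *: h))^T) =
    'd ((fun q => dotp q h) \o grad f) (p + t *: h) h.
  rewrite diff_comp//= de -deriveE// deriveEjacobian// /dotp.
  under eq_bigr do rewrite mxE mulr_sumr.
  rewrite exchange_big/=; apply: eq_bigr => i _.
  rewrite mxE mulr_suml; apply: eq_bigr => j _.
  by rewrite !mxE; ring.
exact: (@is_derive_line _ ((fun q => dotp q h) \o grad f) _ _ _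
  (differentiable_comp df dd)).
Qed.

Lemma mvt_upto (phi dphi : R -> R) (t : R) : 0 <= t ->
  (forall s, 0 <= s <= t -> is_derive s 1 phi (dphi s)) ->
  exists2 s, 0 <= s <= t & phi t - phi 0 = dphi s * t.
Proof.
move=> t0 dphiP.
have [s||s] := @MVT_segment R phi dphi 0 t t0.
- by rewrite in_itv/= => /andP[/ltW s0 /ltW s1]; apply: dphiP; rewrite s0.
- apply: continuous_in_subspaceT => s'.
  rewrite inE/= in_itv/= => /dphiP ds.
  apply: differentiable_continuous; apply/derivable1_diffP.
  exact: ex_derive.
- by rewrite in_itv/= subr0 => s01 E; exists s.
Qed.

(** Two applications of the mean value theorem.  The Hessian bound makes the
    slope t |-> <grad f(p + t h), h> grow at rate at most L |h|^2; hence f along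
    the segment minus the quadratic model has nonpositive derivative. *)
Lemma descent_lemma f p h (L : R) :
  (forall t : R, 0 <= t <= 1 -> [/\ differentiable f (p + t *: h),
    differentiable (grad f) (p + t *: h) &
    spectral_norm (hess f (p + t *: h)) <= L]) ->
  f (p + h) <= f p + dotp (grad f p) h + L / 2 * dotp h h.
Proof.
move=> H.
have grad_lip (t : R) : 0 <= t <= 1 ->
    dotp (grad f (p + t *: h)) h - dotp (grad f p) h <= L * dotp h h * t.
  move=> /andP[t0 t1].
  have [s /andP[s0 st]|s /andP[s0 st]] := @mvt_upto
    (fun s : R => dotp (grad f (p + s *: h)) h)
    (fun s : R => dotp h (h *m (hess f (p + s *: h))^T)) t t0.
    by have [] := H s; [rewrite s0 (le_trans st)|
                        move=> _ ? _; exact: is_derive_grad_line].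
  rewrite scale0r addr0 => ->; apply: ler_wpM2r => //.
  apply: le_trans (dotp_le_enorm _ _) _.
  rewrite -sqr_enorm expr2 mulrCA; apply: ler_wpM2l; first exact: enorm_ge0.
  apply: le_trans (enorm_mulmx _ _) _; apply: ler_wpM2r; first exact: enorm_ge0.
  by have [] := H s; rewrite ?s0 ?(le_trans st).
pose c := dotp (grad f p) h; pose k := L / 2 * dotp h h.
have [s s01|s s01] := @mvt_upto
    (fun s : R => f (p + s *: h) - (s * c + s ^+ 2 * k))
    (fun s : R => dotp (grad f (p + s *: h)) h - (c + 2 * s * k)) 1 ler01.
  have [df _ _] := H s s01.
  have := is_derive_f_line df => d1.
  have d2 : is_derive s 1 (fun s : R => s * c + s ^+ 2 * k) (c + 2 * s * k).
    have -> : (fun s : R => s * c + s ^+ 2 * k) =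
        ((id : R -> R) * cst c + (id : R -> R) ^+ 2 * cst k) by [].
    by apply: is_derive_eq; rewrite /GRing.scale/= !fctE/=; ring.
  exact: is_deriveB.
rewrite !scale1r !scale0r addr0 mul0r expr0n/= mul0r addr0 subr0.
rewrite mulr1 expr1n !mul1r.
have := grad_lip s s01; rewrite /k /c; lra.
Qed.
End calculus.

(** * Projection onto a compact convex set *)

Section projection.
Context {R : realType} {n : nat}.
Implicit Types (C : set 'rV[R]_n) (x c : 'rV[R]_n).

Lemma continuous_enormB x : continuous (fun q : 'rV[R]_n => enorm (x - q)).
Proof.
move=> q; suff : (fun q => enorm (x - q)) @ nbhs q --> enorm (x - q) by [].
by apply: cvg_enorm; apply: cvgB; [exact: cvg_cst|exact: cvg_id].
Qed.

Lemma nearest_point C x : C !=set0 -> compact C ->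
  exists2 q, C q & forall c, C c -> enorm (x - q) <= enorm (x - c).
Proof.
move=> C0 cC.
have [|q /set_mem Cq qmin] := @EVT_min_rV R n (fun q => enorm (x - q)) C C0 cC.
  by apply: continuous_subspaceT; exact: continuous_enormB.
by exists q => // c Cc; apply: qmin; exact: mem_set.
Qed.

Lemma projP C x : C !=set0 -> compact C ->
  C (Defs.proj C x) /\
  forall c, C c -> enorm (x - Defs.proj C x) <= enorm (x - c).
Proof.
move=> C0 cC; rewrite /Defs.proj.
have [q Cq qmin] := nearest_point x C0 cC.
exact: (@getPex _
  [set q | C q /\ forall c, C c -> enorm (x - q) <= enorm (x - c)]
  (ex_intro _ q (conj Cq qmin))).
Qed.

(** For t in (0, 1] the point q + t (c - q) lies in C, hence is at least as far
    from x as the projection q.  Expanding the squares gives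
    2 <x - q, c - q> <= t |c - q|^2, and t is arbitrarily small. *)
Lemma proj_obtuse C x c : C !=set0 -> compact C -> @convex_set R 'rV[R]_n C ->
  C c -> dotp (x - Defs.proj C x) (c - Defs.proj C x) <= 0.
Proof.
move=> C0 cC cvxC Cc; have [] := projP x C0 cC.
set q := Defs.proj C x => Cq qmin.
set a := dotp (x - q) (c - q); set b := dotp (c - q) (c - q).
have b0 : 0 <= b by exact: dotp_ge0.
have ab (t : R) : 0 < t -> t <= 1 -> 2 * a <= t * b.
  move=> t0 t1.
  have t01 : Itv.spec (@Itv.num_sem R) (Itv.Real `[0, 1]%Z) t.
    by rewrite /Itv.spec/= /Itv.num_sem/= num_real/= in_itv/= (ltW t0) t1.
  have := cvxC c q (Itv.mk t01) (mem_set Cc) (mem_set Cq).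
  rewrite inE => /qmin.
  have -> : conv (Itv.mk t01) (c : convex_lmodType _) (q : convex_lmodType _) =
      q + t *: (c - q).
    change (t *: c + (1 - t) *: q = q + t *: (c - q)).
    by rewrite scalerBl scale1r scalerBr addrCA.
  rewrite enorm_le ?enorm_ge0// sqr_enorm.
  have -> : x - (q + t *: (c - q)) = (x - q) - t *: (c - q).
    by rewrite opprD addrA.
  rewrite dotp_sqrB -/a -/b => h.
  by rewrite -(ler_pM2l t0); lra.
rewrite leNgt; apply/negP => a0.
(* If a were positive, t := min 1 (a / b) would give 2 a <= t b <= a. *)
have : 2 * a <= b by have := ab 1 ltr01 (lexx _); rewrite mul1r.
have bp : 0 < b by have := ab 1 ltr01 (lexx _); rewrite mul1r; lra.
have := ab (Num.min 1 (a / b)); rewrite lt_min ltr01 divr_gt0// ge_min lexx/=.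
move=> /(_ isT isT) h _.
have : Num.min 1 (a / b) * b <= a by rewrite -ler_pdivlMr// ge_min lexx orbT.
lra.
Qed.

End projection.

(** * Distances and the safe tube *)

Section distance.
Context {R : realType} {n : nat}.
Implicit Types (A B F U : set 'rV[R]_n).

Lemma set_dist_le A B a b : A a -> B b ->
  (set_dist A B <= (enorm (a - b))%:E)%E.
Proof. by move=> Aa Bb; apply: ereal_inf_lbound; exists a, b. Qed.

Lemma closure_dist_gt0 A B : (0 < set_dist A B)%E -> closure A `<=` ~` B.
Proof.
move=> d0 q clq Bq.
have : \forall a \near q, ((enorm (q - a))%:E < set_dist A B)%E.
  have q0 : (fun a => enorm (q - a)) @ nbhs q --> (0 : R).
    by rewrite -(@enorm0 R n) -(subrr q); exact: continuous_enormB.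
  case: (set_dist A B) d0 => [d| |]//; last first.
    by move=> _; apply: filterE => a; exact: ltry.
  by rewrite lte_fin => d0; exact: (cvgr_lt _ q0 _ d0).
move=> /clq[a [Aa]]; rewrite enormB ltNge => /negP; apply.
exact: set_dist_le.
Qed.

Lemma closed_ball_enorm_compact (r : R) :
  compact [set v : 'rV[R]_n | enorm v <= r].
Proof.
apply: bounded_closed_compact.
  exists r; split; first exact: num_real.
  move=> M rM v /= vr; apply: le_trans (norm_le_enorm _) _.
  exact: le_trans vr (ltW rM).
have := @closed_comp _ R (fun v : 'rV[R]_n => enorm v) [set x | x <= r].
apply; last exact: closed_le.
move=> v _; suff : (fun q => enorm q) @ nbhs v --> enorm v by [].
by apply: cvg_enorm; exact: cvg_id.
Qed.

(** Over a compact set the infimum defining the distance is attained. *)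
Lemma neighborhoodE F (r : R) : F !=set0 -> compact F ->
  neighborhood F r = [set q | exists2 p, F p & enorm (q - p) <= r].
Proof.
move=> F0 cF; apply/seteqP; split => q /=.
  move=> dr; have [p Fp pmin] := nearest_point q F0 cF; exists p => //.
  rewrite -lee_fin; apply: le_trans dr.
  apply: le_ereal_inf_tmp => _ [a [b [/= -> Fb ->]]].
  by rewrite lee_fin; exact: pmin.
move=> [p Fp pr]; apply: (@le_trans _ _ (enorm (q - p))%:E).
  exact: set_dist_le.
by rewrite lee_fin.
Qed.

Lemma neighborhood_compact F (r : R) : F !=set0 -> compact F ->
  compact (neighborhood F r).
Proof.
move=> F0 cF; rewrite neighborhoodE//.
have -> : [set q | exists2 p, F p & enorm (q - p) <= r] =
    (fun z : 'rV[R]_n * 'rV[R]_n => z.1 + z.2) @`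
      (F `*` [set v | enorm v <= r]).
  apply/seteqP; split => [q [p Fp pr]|_ [[p v] [/= Fp vr] <-]].
    by exists (p, q - p) => //=; rewrite subrKC.
  by exists p => //; rewrite addrAC subrr add0r.
apply: continuous_compact.
  by apply: continuous_subspaceT => z; exact: add_continuous.
by apply: compact_setX => //; exact: closed_ball_enorm_compact.
Qed.

(** When the complement of U is nonempty the radius is at most half of a finite
    positive distance; when U is the whole space the distance is infinite, the
    radius is 1, and there is nothing to leave. *)
Lemma safe_radius_spec U F : F !=set0 -> (0 < set_dist F (~` U))%E ->
  0 < safe_radius U F /\
  forall p q, F p -> enorm (q - p) <= safe_radius U F -> U q.
Proof.
move=> [p0 Fp0] d0; rewrite /safe_radius.
have step p q : F p -> ~ U q -> (set_dist F (~` U) <= (enorm (q - p))%:E)%E.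
  by move=> Fp Uq; rewrite enormB; exact: set_dist_le.
case: (set_dist F (~` U)) d0 step => [d| |]//.
- rewrite lte_fin => d0 step; rewrite -EFinM -EFin_min/=.
  have d2 : 0 < d * 2^-1 by rewrite divr_gt0.
  split; first by rewrite lt_min ltr01.
  move=> p q Fp; rewrite le_min => /andP[_ qd].
  apply: contrapT => /(step _ _ Fp); rewrite lee_fin; lra.
- move=> _ step; rewrite gt0_mulye ?lte_fin ?invr_gt0// (min_idPl _) ?leey//=.
  split => // p q Fp _; apply: contrapT => /(step _ _ Fp).
  by rewrite leye_eq.
Qed.

End distance.

(** * Compactness of sublevel sets and maxima *)

Section sublevel_sets.
Context {R : realType} {n : nat}.
Implicit Types (C U K : set 'rV[R]_n) (f : 'rV[R]_n -> R).

(** The sublevel set could fail to be closed only by accumulating at a point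
    outside U, which the positive distance excludes; at a limit point in U, the
    inequality passes to the limit by continuity. *)
Lemma sublevel_compact C U f (a : R) : compact C ->
  (forall p, U p -> {for p, continuous f}) ->
  (0 < set_dist (sublevel C U f a) (~` U))%E ->
  compact (sublevel C U f a).
Proof.
move=> cC cf d0; set F := sublevel C U f a.
have FC : F `<=` C by move=> p [].
apply: (subclosed_compact _ cC FC) => q clq.
have Uq : U q by apply: contrapT; exact: closure_dist_gt0 d0 q clq.
have Cq : C q.
  have /closure_id -> : closed C.
    by apply: compact_closed => //; exact: norm_hausdorff.
  exact: closureS FC _ clq.
split=> //; rewrite leNgt; apply/negP => afq.
have [p [[_ _ fp]]] := clq _ (cvgr_gt _ (cf q Uq) _ afq).
by rewrite ltNge fp.
Qed.

Lemma compact_max_on K (phi : 'rV[R]_n -> R) : K !=set0 -> compact K ->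
  (forall p, K p -> {for p, continuous phi}) ->
  exists m, is_max [set phi p | p in K] m.
Proof.
move=> K0 cK cphi.
have [|q /set_mem Kq qmax] := @EVT_max_rV R n phi K K0 cK.
  by apply: continuous_in_subspaceT => p /set_mem; exact: cphi.
exists (phi q); split; first by exists q.
by move=> _ [p Kp <-]; apply: qmax; exact: mem_set.
Qed.

End sublevel_sets.

(** * The Armijo test for short steps *)

Section armijo.
Context {R : realType} {n : nat}.
Context (C U : set 'rV[R]_n) (f : 'rV[R]_n -> R).
Context (C0 : C !=set0) (cC : compact C) (cvxC : @convex_set R 'rV[R]_n C).
Implicit Types (p : 'rV[R]_n) (a : R).

Lemma trial_in p a : C (trial C f p a).
Proof. exact: (projP _ C0 cC).1. Qed.

(** This is the obtuse angle property of the projection of p - a grad f(p),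
    tested at the point p of C. *)
Lemma trial_descent p a : C p ->
  dotp (trial C f p a - p) (trial C f p a - p) <=
    - (a * dotp (grad f p) (trial C f p a - p)).
Proof.
move=> Cp; have := proj_obtuse (p - a *: grad f p) C0 cC cvxC Cp.
rewrite -/(trial C f p a); set q := trial C f p a.
have -> : p - a *: grad f p - q = - ((q - p) + a *: grad f p).
  by rewrite opprD opprB addrAC.
rewrite -(opprB q p) dotpNl dotpNr opprK dotpDl dotpZl; lra.
Qed.

(** Cauchy-Schwarz on the right-hand side of trial_descent, divided by the
    length of the step. *)
Lemma trial_step_le p a : 0 < a -> C p ->
  enorm (trial C f p a - p) <= a * enorm (grad f p).
Proof.
move=> a0 Cp; set h := trial C f p a - p.
have [h0|h0] := eqVneq (enorm h) 0.
  by rewrite h0 mulr_ge0 ?enorm_ge0 ?ltW.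
have hp : 0 < enorm h by rewrite lt_neqAle eq_sym h0 enorm_ge0.
rewrite -(ler_pM2r hp) -expr2 sqr_enorm.
apply: le_trans (trial_descent a Cp) _; rewrite -/h -mulrN -mulrA ler_pM2l//.
by rewrite -dotpNr -(enormN h); exact: dotp_le_enorm.
Qed.

(** The bound a <= r / G keeps the segment where the Hessian bound holds, and
    a <= 2 (1 - sigma) / L lets the linear decrease absorb the quadratic term of
    the descent lemma. *)
Lemma armijo_small_step sigma r G L p a :
  sigma < 1 -> 0 < G -> 0 < L -> C p -> enorm (grad f p) <= G ->
  (forall q, enorm (q - p) <= r -> [/\ differentiable f q,
     differentiable (grad f) q, U q & spectral_norm (hess f q) <= L]) ->
  0 < a -> a <= r / G -> a <= 2 * (1 - sigma) / L ->
  armijo_test C U f sigma p a.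
Proof.
move=> s1 G0 L0 Cp gG ball a0 arG aL; rewrite /armijo_test/=.
have := trial_descent a Cp; have := trial_step_le a0 Cp.
set q := trial C f p a; set h := q - p => ha hh.
have hr : enorm h <= r.
  apply: le_trans ha _; apply: le_trans (_ : a * G <= r).
    by rewrite ler_pM2l.
  by rewrite -ler_pdivlMr.
split; first by have [] := ball q hr.
have seg (t : R) : 0 <= t <= 1 -> enorm (p + t *: h - p) <= r.
  move=> /andP[t0 t1]; rewrite addrAC subrr add0r enormZ ger0_norm//.
  by apply: le_trans hr; rewrite ler_piMl// enorm_ge0.
have -> : f q = f (p + h) by rewrite subrKC.
apply: le_trans (@descent_lemma R n f p h L _) _.
  by move=> t /seg /ball[].
have aL' : a * L <= 2 * (1 - sigma) by rewrite -ler_pdivlMr.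
have g0 : dotp (grad f p) h <= 0.
  rewrite -(pmulr_rle0 _ a0); have := dotp_ge0 h; lra.
(* The two products that combine linearly into the Armijo inequality. *)
have : L / 2 * dotp h h <= L / 2 * - (a * dotp (grad f p) h).
  by rewrite ler_wpM2l// divr_ge0// ltW.
have : 0 <= - dotp (grad f p) h * (2 * (1 - sigma) - a * L).
  by rewrite mulr_ge0 ?oppr_ge0 ?subr_ge0.
lra.
Qed.

(** The gradient mapping is - h / a with h the step, so the decrease to prove is
    sigma |h|^2 / a, which trial_descent compares with - sigma <grad f(p), h>. *)
Lemma armijo_sufficient_decrease sigma p a : 0 < sigma -> 0 < a -> C p ->
  armijo_test C U f sigma p a ->
  f (trial C f p a) <= f p - sigma * a * enorm (gradient_mapping C f a p) ^+ 2.
Proof.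
move=> s0 a0 Cp [_ /le_trans]; apply.
have := trial_descent a Cp.
rewrite /gradient_mapping -[p - _]opprB scalerN enormN.
set h := trial C f p a - p => hh.
rewrite sqr_enorm dotpZl dotpZr.
have -> : sigma * a * (a^-1 * (a^-1 * dotp h h)) = sigma * (dotp h h / a).
  by field; rewrite gt_eqF.
by rewrite -mulrN lerD2l ler_pM2l// lerNr ler_pdivrMr//; lra.
Qed.

(** * The backtracking loop *)

Section backtracking.
Context (abar sigma rho : R) (p : 'rV[R]_n).
Context (abar0 : 0 < abar) (rho01 : 0 < rho < 1).

(** A reduction to rho a happens only after a was rejected, and a rejected size
    exceeds amin. *)
Lemma backtrack_bounds (amin : R) j a :
  (forall b, 0 < b -> b <= amin -> armijo_test C U f sigma p b) ->
  backtrack C U f abar sigma rho p j a ->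
  0 < a /\ Num.min abar (rho * amin) <= a <= abar.
Proof.
have /andP[r0 r1] := rho01.
move=> small; elim=> [|{}j {}a _ [a0 /andP[al au]] fail].
  by rewrite lexx ge_min lexx.
split; first exact: mulr_gt0.
apply/andP; split.
  rewrite ge_min ler_pM2l//; apply/orP; right.
  by rewrite leNgt; apply/negP => /ltW /(small _ a0).
by apply: le_trans au; rewrite ler_piMl// ltW.
Qed.

(** If no size were ever accepted, the loop would reach rho^j abar for every j,
    and these sizes eventually fall below amin. *)
Lemma backtrack_terminates (amin : R) : 0 < amin ->
  (forall b, 0 < b -> b <= amin -> armijo_test C U f sigma p b) ->
  exists j a, backtrack C U f abar sigma rho p j a /\
              armijo_test C U f sigma p a.
Proof.
have /andP[r0 r1] := rho01.
move=> amin0 small; apply: contrapT => never.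
have bt j : backtrack C U f abar sigma rho p j (rho ^+ j * abar).
  elim: j => [|j IHj]; first by rewrite expr0 mul1r; exact: backtrack_start.
  rewrite exprS -mulrA; apply: (backtrack_reduce IHj) => ok.
  by case: never; exists j, (rho ^+ j * abar); split.
have [j jl] : exists j, rho ^+ j * abar <= amin.
  have rho_cvg : GRing.exp rho @ \oo --> (0 : R).
    by apply: cvg_expr; rewrite ger0_norm// ltW.
  have [j _ /(_ j (leqnn j)) /= h] :=
    cvgr0_norm_le _ rho_cvg (amin / abar) (divr_gt0 amin0 abar0).
  exists j; rewrite -ler_pdivlMr//.
  by apply: le_trans h; exact: ler_norm.
case: never; exists j, (rho ^+ j * abar); split=> //.
by apply: small => //; rewrite mulr_gt0 ?exprn_gt0.
Qed.

End backtracking.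
End armijo.

(** * The projected gradient method *)

Unset Implicit Arguments.

Theorem theorem1 (R : realType) (n : nat) (C U : set 'rV[R]_n)
    (f : 'rV[R]_n -> R) (p0 : 'rV[R]_n) (abar sigma rho eps : R)
    (C_nonempty : C !=set0) (C_compact : compact C)
    (C_convex : @convex_set R 'rV[R]_n C)
    (U_open : open U) (U_convex : @convex_set R 'rV[R]_n U)
    (CU_nonempty : C `&` U !=set0)
    (f_C2 : C2_on U f) (f_convex : @convex_function R 'rV[R]_n U f)
    (blowup : boundary_blowup C U f)
    (p0_CU : (C `&` U) p0) (abar_gt0 : 0 < abar)
    (sigma_01 : 0 < sigma < 1) (rho_01 : 0 < rho < 1) (eps_ge0 : 0 <= eps) :
  let F0 := sublevel C U f (f p0) in
  let r := safe_radius U F0 in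
  let Kr := neighborhood F0 r in
  let generated := iterate C U f abar sigma rho eps p0 in
  let accepted := accepted_step C U f abar sigma rho in
  [/\ (forall k p, generated k p ->
         exists j a, backtrack C U f abar sigma rho p j a /\
                     armijo_test C U f sigma p a),
      (forall k p a, generated k p -> accepted p a -> F0 (trial C f p a)) /\
      (forall k p, generated k p -> F0 p),
      (exists g l : R,
         [/\ is_max [set enorm (grad f p) | p in F0] g,
             is_max [set spectral_norm (hess f q) | q in Kr] l
           & let G := Num.max 1 g in
             let L := Num.max 1 l in
             let alpha_star := Num.min (r / G) (2 * (1 - sigma) / L) in
             let alpha_low := Num.min abar (rho * alpha_star) in
             0 < alpha_low /\
             forall k p a, generated k p -> accepted p a ->
               alpha_low <= a <= abar])
    & (forall k p a, generated k p -> accepted p a ->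
         f (trial C f p a) <=
           f p - sigma * a * enorm (gradient_mapping C f a p) ^+ 2)].
Proof.
move=> F0 r Kr generated accepted.
have /andP[s0 s1] := sigma_01; have /andP[r0 r1] := rho_01.
have F0p0 : F0 p0 by case: p0_CU.
have F0_nonempty : F0 !=set0 by exists p0.
have dist_gt0 := blowup (f p0) F0_nonempty.
have cF0 : compact F0.
  apply: sublevel_compact => // p Up.
  by apply: differentiable_continuous; have [] := f_C2 p Up.
have [rpos ballU] := safe_radius_spec F0_nonempty dist_gt0.
have KrE := neighborhoodE r F0_nonempty cF0.
have KrU q : Kr q -> U q by rewrite /Kr KrE => -[p Fp]; exact: ballU.
have [g g_max] : exists g, is_max [set enorm (grad f p) | p in F0] g.
  apply: compact_max_on => // p [_ Up _].
  have [_ dgrad _] := f_C2 p Up.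
  exact: cvg_enorm (differentiable_continuous dgrad).
have [l l_max] : exists l, is_max [set spectral_norm (hess f q) | q in Kr] l.
  apply: compact_max_on; last 1 first.
  - move=> q /KrU Uq; have [_ _ chess] := f_C2 q Uq.
    exact: cvg_spectral_norm chess.
  - exists p0; rewrite /Kr KrE; exists p0 => //.
    by rewrite subrr enorm0 ltW.
  - exact: neighborhood_compact.
pose G := Num.max 1 g; pose L := Num.max 1 l.
pose alpha_star := Num.min (r / G) (2 * (1 - sigma) / L).
have G0 : 0 < G by rewrite lt_max ltr01.
have L0 : 0 < L by rewrite lt_max ltr01.
have star0 : 0 < alpha_star.
  by rewrite lt_min !divr_gt0// mulr_gt0// subr_gt0.
have small p : F0 p -> forall a, 0 < a -> a <= alpha_star ->
    armijo_test C U f sigma p a.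
  move=> F0p a a0; rewrite le_min => /andP[ar aL].
  have [Cp _ _] := F0p.
  apply: (@armijo_small_step R n C U f C_nonempty C_compact C_convex
    sigma r G L) => //.
    by rewrite le_max (g_max.2 (enorm (grad f p))) ?orbT//; exists p.
  move=> q qr; have Krq : Kr q by rewrite /Kr KrE; exists p.
  have Uq := KrU q Krq; have [df dgf _] := f_C2 q Uq; split=> //.
  by rewrite le_max (l_max.2 (spectral_norm (hess f q))) ?orbT//; exists q.
have bounds p a : F0 p -> accepted p a ->
    0 < a /\ Num.min abar (rho * alpha_star) <= a <= abar.
  move=> F0p [[j bt] _].
  exact: (backtrack_bounds abar_gt0 rho_01 (small p F0p) bt).
have step p a : F0 p -> accepted p a -> f (trial C f p a) <=
    f p - sigma * a * enorm (gradient_mapping C f a p) ^+ 2.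
  move=> F0p acc; have [a0 _] := bounds p a F0p acc.
  have [[Cp _ _] [_ ok]] := (F0p, acc).
  exact: (@armijo_sufficient_decrease R n C U f).
have stay p a : F0 p -> accepted p a -> F0 (trial C f p a).
  move=> F0p acc; have [a0 _] := bounds p a F0p acc.
  have [[_ _ fp] [_ [Uq _]]] := (F0p, acc).
  split=> //; first exact: trial_in.
  apply: le_trans fp; apply: le_trans (step p a F0p acc) _.
  by rewrite gerBl mulr_ge0 ?sqr_ge0// mulr_ge0 ?ltW.
have inv k p : generated k p -> F0 p.
  by elim=> [//|{}k {}p a _ F0p acc _]; exact: stay.
split.
- move=> k p /inv F0p.
  exact: (backtrack_terminates abar_gt0 rho_01 star0 (small p F0p)).
- by split=> [k p a /inv|]; [exact: stay|exact: inv].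
- exists g, l; split=> //=; split; first by rewrite lt_min abar_gt0 mulr_gt0.
  by move=> k p a /inv F0p acc; have [] := bounds p a F0p acc.
- by move=> k p a /inv; exact: step.
Qed.
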